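(* Let $c\geq 3$ and let $G_1, G_2, \ldots, G_c$ be oriented graphs on a common set of $n$ vertices. If $\sum_{i = 1}^c e(G_i) > \frac{c}{3}n^2$, then there exists a rainbow transitive triangle.
   Context: A directed graph $G$ consists of a vertex set $V(G)$ and an edge set $E(G)$ of ordered pairs of distinct vertices (no loops, no multiple edges). An oriented graph is a directed graph with no pair of vertices $u,v$ such that both $(u,v)$ and $(v,u)$ are edges. $e(G)=|E(G)|$. The edges of $G_i$ are thought of as having color $i$. A rainbow transitive triangle is a triple of distinct vertices $u,v,w$ together with pairwise distinct colors $a,b,d$ such that $(u,v)\in E(G_a)$, $(v,w)\in E(G_b)$, $(u,w)\in E(G_d)$. *)

(* Defs.v *)
From mathcomp Require Import all_boot all_order all_algebra.

Set Implicit Arguments.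
Unset Strict Implicit.
Unset Printing Implicit Defensive.

(* A directed graph on the finite vertex set V is given by its edge relation
   E : rel V, where E u v means that the ordered pair (u, v) is an edge. *)

Definition directed_graph (V : finType) (E : rel V) : Prop := irreflexive E.

Definition oriented_graph (V : finType) (E : rel V) : Prop :=
  directed_graph E /\ forall u v : V, ~ (E u v /\ E v u).

Definition edge_set (V : finType) (E : rel V) : {set V * V} :=
  [set p : V * V | E p.1 p.2].

Definition num_edges (V : finType) (E : rel V) : nat := #|edge_set E|.

Definition rainbow_transitive_triangle (V : finType) (c : nat)
    (G : 'I_c -> rel V) (u v w : V) (a b d : 'I_c) : Prop :=
  [/\ uniq [:: u; v; w], uniq [:: a; b; d], G a u v, G b v w & G d u w].

(* Main.v *)
Require Import Defs.
From mathcomp Require Import all_boot all_order all_algebra.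
From mathcomp Require Import zify lra.
Import Order.TTheory GRing.Theory Num.Theory.
Local Open Scope ring_scope.

(** Averaging over cyclically consecutive triples of colours, three colours
  carry more than n^2 edges, so it suffices to treat c = 3.  Let the weight of
  a pair of vertices be its number of edges over the three colours.  Without a
  rainbow transitive triangle, no vertex sends weight over 6 to a triangle of weight
  at least 8 (a finite check).  Hence, by induction, the total weight is at
  most n^2: if every pair has weight at most 2 this is clear; if some triangle
  has weight at least 8, delete it, which loses at most 9 + 6 (n - 3); otherwise
  delete a pair of weight 3, to which every other vertex sends weight at most 4,
  which loses at most 3 + 4 (n - 2). *)

Section WeightBound.
Set Implicit Arguments.
Unset Strict Implicit.
Local Open Scope nat_scope.

Lemma sum_setD_symm (V : finType) (w : V -> V -> nat) (A K : {set V}) :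
  (forall u v, w u v = w v u) -> K \subset A ->
  \sum_(u in A) \sum_(v in A) w u v =
    \sum_(u in A :\: K) \sum_(v in A :\: K) w u v
    + (\sum_(u in A :\: K) \sum_(v in K) w u v).*2
    + \sum_(u in K) \sum_(v in K) w u v.
Proof.
move=> wC sKA.
have splitA (F : V -> nat) :
    \sum_(u in A) F u = \sum_(u in A :\: K) F u + \sum_(u in K) F u.
  by rewrite (big_setID K) /= (setIidPr sKA) addnC.
rewrite splitA (eq_bigr _ (fun u _ => splitA (w u))) big_split /=.
rewrite [X in _ + X](eq_bigr _ (fun u _ => splitA (w u))) big_split /=.
rewrite [X in _ + (X + _)]exchange_big /=.
under [X in _ + (X + _)]eq_bigr do under eq_bigr do rewrite wC.
by rewrite -addnn !addnA.
Qed.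

(** Sums run over ordered pairs, hence the doubled bounds. With m for [#|A :\: K|], the three blocks
    are at most 2m^2, 2(2km) and 2k^2, which add up to 2(m + k)^2. *)
Lemma sum_setD_le (V : finType) (w : V -> V -> nat) (A K : {set V}) (k : nat) :
  (forall u v, w u v = w v u) -> K \subset A -> #|K| = k ->
  (forall x, x \in A -> \sum_(v in K) w x v <= k.*2) ->
  \sum_(u in A :\: K) \sum_(v in A :\: K) w u v <= (#|A :\: K| ^ 2).*2 ->
  \sum_(u in A) \sum_(v in A) w u v <= (#|A| ^ 2).*2.
Proof.
move=> wC sKA cK wK IH; rewrite (sum_setD_symm wC sKA).
have le_sum (B : {set V}) : B \subset A ->
    \sum_(u in B) \sum_(v in K) w u v <= #|B| * k.*2.
  move=> sBA; rewrite -sum_nat_const; apply: leq_sum => u uB.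
  by apply: wK; apply: subsetP uB.
have := le_sum _ (subsetDl A K); have := le_sum _ sKA; rewrite cK.
have -> : #|A| = #|A :\: K| + k by rewrite -cK cardsDS // subnK ?subset_leq_card.
nia.
Qed.

Lemma sum_weight_le (V : finType) (w : V -> V -> nat) :
    (forall u v, w u v = w v u) -> (forall u, w u u = 0) ->
    (forall u v, w u v <= 3) ->
    (forall u v y x, 8 <= w u v + w v y + w u y ->
      w x u + w x v + w x y <= 6) ->
  forall A : {set V}, \sum_(u in A) \sum_(v in A) w u v <= (#|A| ^ 2).*2.
Proof.
move=> wC w0 w3 w6 A; have [m] := ubnP #|A|; elim: m A => // m IH A ltAm.
have IHD (K : {set V}) : K \subset A -> 0 < #|K| ->
    \sum_(u in A :\: K) \sum_(v in A :\: K) w u v <= (#|A :\: K| ^ 2).*2.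
  move=> sKA K0; apply: IH; rewrite cardsDS //.
  by have := subset_leq_card sKA; lia.
case: (boolP [exists u in A, exists v in A, exists y in A,
    8 <= w u v + w v y + w u y]) => [|/exists_inPn noT].
  case/exists_inP=> u uA /exists_inP[v vA] /exists_inP[y yA] wT.
  (* If two of the vertices coincide, one weight is 0 and the other two add up to at most 6. *)
  have [nuv nuy nvy] : [/\ u != v, u != y & v != y].
    split; apply/eqP=> E; subst; move: wT; rewrite w0;
      [have := w3 v y | have := w3 v y | have := w3 u y]; rewrite ?(wC y v); lia.
  have sumK F : \sum_(z in [set u; v; y]) F z = F u + F v + F y :> nat.
    rewrite setUC big_setU1 ?inE ?negb_or /=; last by rewrite !(eq_sym y) nuy.
    by rewrite big_setU1 ?inE //= big_set1; lia.
  have cK : #|[set u; v; y]| = 3 by rewrite -sum1_card sumK.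
  have sKA : [set u; v; y] \subset A.
    by apply/subsetP=> z; rewrite !inE => /orP[/orP[]|] /eqP->.
  apply: (sum_setD_le _ sKA cK) => // [x _|]; last by apply: IHD; rewrite ?cK.
  by rewrite sumK; apply: w6.
have{}noT u v y : u \in A -> v \in A -> y \in A -> w u v + w v y + w u y <= 7.
  move=> uA vA yA; have /exists_inPn/(_ v vA)/exists_inPn/(_ y yA) := noT u uA.
  by lia.
case: (boolP [exists u in A, exists v in A, 2 < w u v]) => [|/exists_inPn w2].
  case/exists_inP=> u uA /exists_inP[v vA] wuv.
  have nuv : u != v by apply/eqP=> E; move: wuv; rewrite E w0.
  have sumK F : \sum_(z in [set u; v]) F z = F u + F v :> nat.
    by rewrite big_setU1 ?inE //= big_set1.
  have cK : #|[set u; v]| = 2 by rewrite cards2 nuv.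
  have sKA : [set u; v] \subset A.
    by apply/subsetP=> z; rewrite !inE => /orP[] /eqP->.
  apply: (sum_setD_le _ sKA cK) => // [x xA|]; last by apply: IHD; rewrite ?cK.
  (* The bound 7 on [u], [v], [x], minus the weight 3 of [u], [v], leaves at most 4. *)
  by rewrite sumK; have := noT u v x uA vA xA; rewrite (wC x u) (wC x v); lia.
apply: (@leq_trans (\sum_(u in A) \sum_(v in A) 2)).
  apply: leq_sum => u uA; apply: leq_sum => v vA.
  by have /exists_inPn/(_ v vA) := w2 u uA; rewrite -leqNgt.
by rewrite !sum_nat_const; lia.
Qed.

End WeightBound.

Section PairStates.
Set Implicit Arguments.
Unset Strict Implicit.
Local Open Scope nat_scope.

(* Entry i of the state of (u, v) tells whether colour i has the edge from u
   to v and whether it has the edge from v to u. *)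
Definition pair_state := seq (bool * bool).

(** The value [(true, true)] is absent because the graphs are oriented; a pair thus has 3^3 = 27
    states. *)
Definition orientations : seq (bool * bool) :=
  [:: (false, false); (true, false); (false, true)].

Definition pair_states : seq pair_state :=
  [seq p :: q | p <- orientations,
    q <- [seq [:: q; r] | q <- orientations, r <- orientations]].

Definition state_weight (s : pair_state) : nat :=
  sumn [seq (p.1 + p.2)%N | p : bool * bool <- s].

Definition state_flip (s : pair_state) : pair_state := [seq (p.2, p.1) | p <- s].

Definition state_edge (s : pair_state) (i : nat) : bool :=
  (nth (false, false) s i).1.

Definition color_triples : seq (nat * nat * nat) :=
  [:: (0, 1, 2); (0, 2, 1); (1, 0, 2); (1, 2, 0); (2, 0, 1); (2, 1, 0)].

Definition rainbow_path (uv vw uw : pair_state) : bool :=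
  has (fun t => [&& state_edge uv t.1.1, state_edge vw t.1.2
                  & state_edge uw t.2]) color_triples.

(** A transitive triangle orders its vertices; the disjuncts run over the six orders. *)
Definition rainbow_free (uv vw uw : pair_state) : bool :=
  let vu := state_flip uv in let wv := state_flip vw in
  let wu := state_flip uw in
  ~~ [|| rainbow_path uv vw uw, rainbow_path uw wv uv, rainbow_path vu uw vw,
         rainbow_path vw wu vu, rainbow_path wu uv wv | rainbow_path wv vu wu].

(** Filtering first keeps the check small: only these triangles are extended by a fourth vertex. *)
Definition heavy_triangles : seq (pair_state * pair_state * pair_state) :=
  [seq t <- [seq (uv, p.1, p.2) | uv <- pair_states,
              p <- [seq (vy, uy) | vy <- pair_states, uy <- pair_states]]
   | (8 <= state_weight t.1.1 + state_weight t.1.2 + state_weight t.2)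
     && rainbow_free t.1.1 t.1.2 t.2].

(* vm_compute evaluates both arguments of ==>, so the pruning needs if. *)
Definition no_heavy_extension (t : pair_state * pair_state * pair_state) : bool :=
  all (fun xu => all (fun xv =>
    if rainbow_free xu t.1.1 xv then
      all (fun xy =>
        if 6 < state_weight xu + state_weight xv + state_weight xy then
          ~~ (rainbow_free xv t.1.2 xy && rainbow_free xu t.2 xy)
        else true) pair_states
    else true) pair_states) pair_states.

(** By evaluation: joining [x] to a heavy triangle with weight over 6 makes one of the three new
    triangles rainbow. *)
Lemma all_no_heavy_extension : all no_heavy_extension heavy_triangles.
Proof. by vm_compute. Qed.

End PairStates.

Section ThreeColors.
Set Implicit Arguments.
Unset Strict Implicit.
Local Open Scope nat_scope.

(** The first hypothesis at [u = v] excludes loops, so the second, though stated for all [u], [v],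
    [w], only restricts distinct vertices. *)
Lemma sum_three_edges_le (V : finType) (E : nat -> rel V) :
    (forall i u v, ~~ (E i u v && E i v u)) ->
    (forall i j k u v w, uniq [:: i; j; k] -> all (gtn 3) [:: i; j; k] ->
      ~~ [&& E i u v, E j v w & E k u w]) ->
  num_edges (E 0) + num_edges (E 1) + num_edges (E 2) <= #|V| ^ 2.
Proof.
move=> Eor Efree.
pose st u v : pair_state := [seq (E i u v, E i v u) | i <- iota 0 3].
have st_in u v : st u v \in pair_states.
  rewrite /st /=; have := Eor 0 u v; have := Eor 1 u v; have := Eor 2 u v.
  by do 6 case: (E _ _ _).
have flipE u v : state_flip (st u v) = st v u by [].
have edgeE u v i : i < 3 -> state_edge (st u v) i = E i u v.
  by case: i => [|[|[|]]].
have pathF u v w : rainbow_path (st u v) (st v w) (st u w) = false.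
  apply/hasPn=> -[[i j] k] tin /=.
  have /andP[ijk_uniq ijk_lt] : uniq [:: i; j; k] && all (gtn 3) [:: i; j; k].
    by move: tin; rewrite !inE; do ![case/orP]; case/eqP=> -> -> ->.
  have /and4P[i3 j3 k3 _] := ijk_lt.
  by rewrite !edgeE // Efree.
have freeT u v w : rainbow_free (st u v) (st v w) (st u w).
  by rewrite /rainbow_free !flipE !pathF.
pose w u v := state_weight (st u v).
have wE u v : w u v = \sum_(i < 3) (E i u v + E i v u).
  by rewrite !big_ord_recl big_ord0.
have wC u v : w u v = w v u.
  by rewrite !wE; apply: eq_bigr => i _; rewrite addnC.
have w0 u : w u u = 0.
  by rewrite wE big1 // => i _; have := Eor i u u; case: (E _ _ _).
have w3 u v : w u v <= 3.
  rewrite wE -[leqRHS](card_ord 3) -sum1_card; apply: leq_sum => i _.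
  by have := Eor i u v; do 2 case: (E _ _ _).
have w6 u v y x : 8 <= w u v + w v y + w u y -> w x u + w x v + w x y <= 6.
  move=> wT; rewrite leqNgt; apply/negP=> wx.
  have T : (st u v, st v y, st u y) \in heavy_triangles.
    rewrite mem_filter; apply/andP; split; first by rewrite /= freeT andbT.
    by apply/allpairsPdep; exists (st u v), (st v y, st u y); rewrite allpairs_f.
  have /allP/(_ _ (st_in x u))/allP/(_ _ (st_in x v)) :=
    allP all_no_heavy_extension _ T.
  rewrite freeT => /allP/(_ _ (st_in x y)) /=.
  by rewrite -!/(w _ _) wx !freeT.
have sumE i : num_edges (E i) = \sum_u \sum_v E i u v.
  rewrite pair_big /= /num_edges -sum1_card big_mkcond /=.
  by apply: eq_bigr => -[u v] _; rewrite inE; case: (E _ _ _).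
have := sum_weight_le wC w0 w3 w6 setT.
(* An edge from [u] to [v] is counted in [w u v] and in [w v u]. *)
rewrite cardsT; suff -> : \sum_(u in setT) \sum_(v in setT) w u v =
    (num_edges (E 0) + num_edges (E 1) + num_edges (E 2)).*2 by rewrite leq_double.
have -> : num_edges (E 0) + num_edges (E 1) + num_edges (E 2) =
    \sum_u \sum_v \sum_(i < 3) E i u v.
  rewrite !sumE -!big_split /=; apply: eq_bigr => u _; rewrite -!big_split /=.
  by apply: eq_bigr => v _; rewrite !big_ord_recl big_ord0 /= addn0 addnA.
rewrite -addnn [X in _ = _ + X]exchange_big -big_split /=.
apply: eq_big => [u|u _]; first by rewrite inE.
rewrite -big_split; apply: eq_big => [v|v _]; first by rewrite inE.
by rewrite wE big_split.
Qed.

(** Each index lies in three of the m + 3 triples i, i + 1, i + 2 modulo m + 3, so the triples have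
    average sum over [k]. *)
Lemma cyclic_triple_sum (m k : nat) (f : 'I_m.+3 -> nat) :
  m.+3 * k < 3 * \sum_i f i ->
  exists a b d : 'I_m.+3, uniq [:: a; b; d] /\ k < f a + f b + f d.
Proof.
move=> lt_k.
have [/existsP[i ki]|/existsPn le_k] :=
    boolP [exists i : 'I_m.+3, k < f i + f (i + 1)%R + f (i + 1 + 1)%R].
  exists i, (i + 1)%R, (i + 1 + 1)%R; split=> //=.
  (* Cancelling [i] leaves 0, 1 and 1 + 1, which are distinct modulo m + 3. *)
  rewrite !inE -addrA -[X in X == _]addr0 -[X in _ || (X == _)]addr0.
  by rewrite !(inj_eq (addrI i)).
move: lt_k; rewrite ltnNge => /negP[].
have shift (g : 'I_m.+3 -> nat) : \sum_i g (i + 1)%R = \sum_i g i.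
  by rewrite [RHS](reindex_inj (addIr 1%R)).
have -> : 3 * \sum_i f i = \sum_i (f i + f (i + 1)%R + f (i + 1 + 1)%R).
  have /= shift2 := shift (fun i => f (i + 1)%R).
  by rewrite !big_split /= shift2 (shift f) !mulSn addn0 addnA.
rewrite -[X in _ <= X * _](card_ord m.+3) -sum_nat_const.
by apply: leq_sum => i _; rewrite leqNgt.
Qed.

End ThreeColors.

Theorem theorem10 (c : nat) (hc : (3 <= c)%N) (V : finType) (n : nat)
    (hn : #|V| = n) (G : 'I_c -> rel V)
    (hG : forall i : 'I_c, oriented_graph (G i))
    (he : (c%:R / 3%:R * n%:R ^+ 2 : rat) <
          (\sum_(i < c) num_edges (G i))%N%:R) :
  exists (u v w : V) (a b d : 'I_c), rainbow_transitive_triangle G u v w a b d.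
Proof.
case: c hc G hG he => [|[|[|m]]] // _ G hG he.
have {}he : (m.+3 * n ^ 2 < 3 * \sum_(i < m.+3) num_edges (G i))%N.
  rewrite -(ltr_nat rat) natrM natrX natrM; move: he.
  move: (\sum_(i < _) _)%N => s; lra.
have [a [b [d [abd_uniq lt_abd]]]] := cyclic_triple_sum he.
(* Indices 0, 1, 2 stand for [a], [b], [d]; beyond them the default [a] still gives an oriented
   graph. *)
pose col := nth a [:: a; b; d].
have irr i : irreflexive (G i) by have [] := hG i.
case: (boolP [exists u, exists v, exists w, exists i : 'I_3, exists j : 'I_3,
    exists k : 'I_3, uniq [:: i; j; k] &&
      [&& G (col i) u v, G (col j) v w & G (col k) u w]]) => [|noT].
  case/existsP=> u /existsP[v] /existsP[w] /existsP[i] /existsP[j] /existsP[k].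
  case/andP=> ijk_uniq /and3P[Guv Gvw Guw].
  exists u, v, w, (col i), (col j), (col k); split=> //.
    rewrite /= !inE negb_or andbT -andbA.
    (* Equal vertices would turn one of the three edges into a loop. *)
    by apply/and3P; split; apply/eqP=> E; subst; move: Guv Gvw Guw; rewrite irr.
  move: ijk_uniq; rewrite /= !inE /col !nth_uniq ?ltn_ord //.
move: lt_abd; rewrite ltnNge => /negP[]; rewrite -hn.
apply: (@sum_three_edges_le V (fun i => G (col i))) => [i u v|i j k u v w].
  by apply/negP=> /andP[Guv Gvu]; have [_ /(_ u v)] := hG (col i); apply.
move=> ijk_uniq /and4P[i3 j3 k3 _]; apply: contra noT => T.
apply/existsP; exists u; apply/existsP; exists v; apply/existsP; exists w.
apply/existsP; exists (Ordinal i3); apply/existsP; exists (Ordinal j3).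
by apply/existsP; exists (Ordinal k3); rewrite T andbT.
Qed.
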